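(* Let $G$ and $H$ be finite digraphs, and let $M$ and $N$ be finitely generated abelian groups with $n(M)=n(N)$. Then the number of $M$-flow-continuous mappings $E(G)\to E(H)$ equals the number of $N$-flow-continuous mappings $E(G)\to E(H)$. In other words, the number of $M$-flow-continuous mappings from $G$ to $H$ depends only on $n(M)$.
   Context: Digraphs are finite multidigraphs; loops and parallel edges are allowed. For an abelian group $M$, a map $\varphi:E(G)\to M$ is an $M$-flow if at every vertex $v$ the sum of $\varphi$ over edges leaving $v$ equals the sum of $\varphi$ over edges entering $v$. A mapping $f:E(G)\to E(H)$ is $M$-flow-continuous if for every $M$-flow $\varphi$ on $H$ the composition $\varphi\circ f$ is an $M$-flow on $G$. Every finitely generated abelian group is isomorphic to $\mathbb{Z}^\alpha\times\prod_{i=1}^k\mathbb{Z}_{n_i}^{\beta_i}$. Set $n(M)=\infty$ if $\alpha>0$, and otherwise $n(M)=\operatorname{lcm}(n_1,\dots,n_k)$; equivalently, $n(M)$ is the largest order of an element of $M$. *)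

(* Defs.v *)
From HB Require Import structures.
From mathcomp Require Import all_boot all_order all_algebra.
From mathcomp Require Import boolp classical_sets.

Set Implicit Arguments.
Unset Strict Implicit.
Unset Printing Implicit Defensive.

Import GRing.Theory.
Local Open Scope ring_scope.

Record digraph := Digraph {
  vertex : finType;
  edge : finType;
  source : edge -> vertex;
  target : edge -> vertex
}.

Definition is_flow (M : zmodType) (G : digraph) (phi : edge G -> M) : Prop :=
  forall v : vertex G,
    \sum_(e : edge G | source e == v) phi e =
    \sum_(e : edge G | target e == v) phi e.

Definition flow_continuous (M : zmodType) (G H : digraph)
    (f : edge G -> edge H) : Prop :=
  forall phi : edge H -> M, is_flow phi -> is_flow (phi \o f).

Definition nb_flow_continuous (M : zmodType) (G H : digraph) : nat :=
  #|[set f : {ffun edge G -> edge H} | `[< flow_continuous M f >] ]%SET|.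

Definition finitely_generated (M : zmodType) : Prop :=
  exists (m : nat) (s : m.-tuple M), forall x : M, inIntSpan s x.

(* The product of the groups (Z/n)^b over the pairs (n, b) in s.  Since 'Z_n is
   Z/n only for n > 1, it is used only under that condition.  'rV_0 is the
   trivial group. *)
Fixpoint torsion_part (s : seq (nat * nat)) : zmodType :=
  if s is (n, b) :: s' then ('rV['Z_n]_b * torsion_part s')%type : zmodType
  else 'rV[int]_0.

Definition decomposition (M : zmodType) (a : nat) (s : seq (nat * nat)) : Prop :=
  all (fun p => (1 < p.1)%N && (0 < p.2)%N) s /\
  exists h : {additive M -> ('rV[int]_a * torsion_part s)%type}, bijective h.

(* None stands for infinity. *)
Definition decomposition_value (a : nat) (s : seq (nat * nat)) : option nat :=
  if (0 < a)%N then None else Some (\big[lcmn/1%N]_(p <- s) p.1).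

(* n(M), read off some decomposition of M: all decompositions of M give the same
   value, and the default of xget is used only if M has no decomposition, so
   never for a finitely generated M. *)
Definition n_of (M : zmodType) : option nat :=
  xget None [set n | exists (a : nat) (s : seq (nat * nat)),
    decomposition M a s /\ n = decomposition_value a s]%classic.

(* Main.v *)
(* Every M-flow on H is a combination, with coefficients in M, of integer flows.
   Hence f is M-flow-continuous iff, for each integer flow psi on H, the excess
   of psi \o f at each vertex of G annihilates M.  By the structure theorem, the
   integers that annihilate M are the multiples of n(M) (only 0 if n(M) is
   infinite), so the condition depends on M through n(M) alone. *)

From HB Require Import structures.
Require Import Defs.
From mathcomp Require Import all_boot all_order all_algebra.
From mathcomp Require Import boolp.
From mathcomp Require classical_sets.

Set Implicit Arguments.
Unset Strict Implicit.
Unset Printing Implicit Defensive.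

Import GRing.Theory.
Local Open Scope ring_scope.

(** * Flows *)

(** The two terms cancel for a loop, so loops never affect conservation. *)
Definition incidence (G : digraph) (e : edge G) (v : vertex G) : int :=
  (source e == v)%:R - (target e == v)%:R.

Lemma is_flowP (M : zmodType) (G : digraph) (phi : edge G -> M) :
  is_flow phi <-> forall v, \sum_e phi e *~ incidence e v = 0.
Proof.
have E v : \sum_e phi e *~ incidence e v =
    \sum_(e | source e == v) phi e - \sum_(e | target e == v) phi e.
  rewrite [in RHS]big_mkcond [X in _ - X]big_mkcond -sumrB; apply: eq_bigr => e _.
  by rewrite /incidence mulrzBr; do 2!case: (_ == v).
by split=> [H v|H v]; [rewrite E H subrr | apply/subr0_eq; rewrite -E].
Qed.

(** Both types are kept: [w] stays as an isolated vertex when [u != w], and edges joining [u] and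
    [w] become loops. Thus a function on the edges of [G] is also one on those of the
    contraction. *)
Definition contract (G : digraph) (u w : vertex G) : digraph :=
  let c v := if v == w then u else v in
  @Digraph (vertex G) (edge G) (c \o @source G) (c \o @target G).

Lemma incidence_contract (G : digraph) (u w : vertex G) (e : edge G) v :
  u != w ->
  @incidence (contract u w) e v =
    if v == w then 0 else
    if v == u then incidence e u + incidence e w else incidence e v.
Proof.
move=> uw; rewrite /incidence /=.
have wu : (w == u) = false by rewrite eq_sym (negPf uw).
have E x : ((if x == w then u else x) == v)%:R =
  (if v == w then 0 else if v == u then (x == u)%:R + (x == w)%:R
   else (x == v)%:R) :> int.
  have [->|xw] := eqVneq x w.
    have [->|vw] := eqVneq v w; first by rewrite (negPf uw).
    by have [_|_] := eqVneq v u; rewrite ?wu ?add0r.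
  have [->|vw] := eqVneq v w; first by rewrite (negPf xw).
  by have [->|vu] := eqVneq v u; rewrite ?addr0.
rewrite !E; case: (v == w); first by rewrite subrr.
by case: (v == u); rewrite // opprD addrACA.
Qed.

(* Contract a non-loop edge [e0], apply induction, and correct each flow of the
   contraction along [e0]. *)
Lemma integral_flow_decomposition (G : digraph) :
  exists2 psi : edge G -> edge G -> int, (forall j, is_flow (psi j)) &
  forall (M : zmodType) (phi : edge G -> M), is_flow phi ->
    forall e, phi e = \sum_j phi j *~ psi j e.
Proof.
have [n] := ubnP #|[pred e : edge G | source e != target e]|.
elim: n G => // n IHn G; rewrite ltnS => leG.
have [/existsP[e0 nl0]|/existsPn loops] :=
    boolP [exists e : edge G, source e != target e]; last first.
  (* If all edges are loops, every function is a flow, so the indicators of single edges serve. *)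
  exists (fun j e => (j == e)%:R) => [j|M phi _ e].
    apply/is_flowP => v; rewrite big1 // => e _.
    by have /negPn/eqP := loops e; rewrite /incidence => ->; rewrite subrr mulr0z.
  rewrite (bigD1 e) //= eqxx mulr1z big1 ?addr0 // => j /negPf->.
  by rewrite mulr0z.
pose w := source e0; pose u := target e0.
have uw : u != w by rewrite eq_sym.
(* The measure drops because loops stay loops and [e0] becomes one. *)
have ltG : (#|[pred e : edge G | @source (contract u w) e != @target (contract u w) e]| < n)%N.
  apply: leq_trans leG; apply: proper_card; apply/properP; split.
    by apply/subsetP => e; rewrite !inE; apply: contraNN => /eqP /= ->.
  by exists e0; rewrite !inE //= -/w -/u eqxx (negPf uw) eqxx.
have [psi psi_flow psiE] := IHn (contract u w) ltG.
(* [B j v] is the excess of [psi j] at [v] in [G]. Being a flow of the contraction, [psi j] can only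
   violate conservation at [u] and [w], with opposite excesses. *)
pose B j v := \sum_e psi j e *~ @incidence G e v.
have e0w : incidence e0 w = 1 by rewrite /incidence eqxx (negPf uw).
have Bother j v : v != w -> v != u -> B j v = 0.
  move=> vw vu; have /is_flowP/(_ v) := psi_flow j.
  by under eq_bigr do rewrite (incidence_contract _ _ uw) (negPf vw) (negPf vu).
have Bu j : B j u = - B j w.
  apply/eqP; rewrite -addr_eq0 -big_split /=; apply/eqP.
  have /is_flowP/(_ u) := psi_flow j; rewrite -[RHS]/0 => {2}<-.
  by apply: eq_bigr => e _; rewrite (incidence_contract _ _ uw) (negPf uw) eqxx mulrzDr.
(* Since [e0] runs from [w] to [u], lowering its value by [B j w] cancels both excesses. *)
exists (fun j e => psi j e - B j w *+ (e == e0)) => [j|M phi phi_flow e].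
  apply/is_flowP => v; under eq_bigr do rewrite mulrzBl.
  rewrite sumrB -/(B j v) [X in _ - X](bigD1 e0) //= eqxx mulr1n [X in _ - (_ + X)]big1.
    rewrite addr0; have [->|vw] := eqVneq v w; first by rewrite e0w mulr1z subrr.
    have [->|vu] := eqVneq v u.
      by rewrite Bu /incidence eqxx (eq_sym _ u) (negPf uw) sub0r mulrNz mulr1z subrr.
    rewrite Bother // /incidence (eq_sym _ v) (negPf vw) (eq_sym _ v) (negPf vu).
    by rewrite [X in _ *~ X]subrr mulr0z subrr.
  by move=> e /negPf->; rewrite mulr0n mul0rz.
have phiE : forall e, phi e = \sum_j phi j *~ psi j e.
  apply: psiE; apply/is_flowP => v; have /is_flowP phi0 := phi_flow.
  under eq_bigr do rewrite (incidence_contract _ _ uw).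
  case: (v == w); first by rewrite big1 // => *; rewrite mulr0z.
  case: (v == u); last exact: phi0.
  by under eq_bigr do rewrite mulrzDr; rewrite big_split /= !phi0 addr0.
under eq_bigr do rewrite mulrzBr.
rewrite sumrB -phiE; apply/esym.
have [_|_] := eqVneq e e0; last by rewrite big1 ?subr0 // => *; rewrite mulr0z.
(* At [e0] the corrections add up to the combination of the [B j w] with coefficients [phi j].
   Expanding [phi] by [phiE] shows that this is the excess of [phi] at [w], which is 0. *)
have /is_flowP/(_ w) := phi_flow.
under eq_bigr => i _ do rewrite phiE mulrz_suml.
rewrite exchange_big /= => S0; rewrite -[RHS]subr0; congr (_ - _); rewrite -[RHS]S0.
apply: eq_bigr => j _; rewrite mulr1n mulrz_sumr; apply: eq_bigr => i _.
by rewrite mulrzz mulrzA.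
Qed.

Definition annihilates (M : zmodType) (k : int) : Prop := forall x : M, x *~ k = 0.

(** Forwards, test [f] on the [M]-flows [x *~ psi]. Backwards, expand an [M]-flow in integer flows:
    its excess after composition with [f] is a combination of the integer excesses, each of which
    kills its coefficient. *)
Lemma flow_continuousP (M : zmodType) (G H : digraph) (f : edge G -> edge H) :
  flow_continuous M f <->
  forall psi : edge H -> int, is_flow psi ->
  forall v, annihilates M (\sum_e psi (f e) *~ incidence e v).
Proof.
split=> [fM psi /is_flowP psi0 v x | fM phi phi_flow].
  have phi_flow : is_flow (fun e => x *~ psi e).
    apply/is_flowP => t; under eq_bigr do rewrite -mulrzA -mulrzz.
    by rewrite -mulrz_sumr psi0 mulr0z.
  have /is_flowP/(_ v) := fM _ phi_flow.
  by under eq_bigr do rewrite /= -mulrzA -mulrzz; rewrite -mulrz_sumr.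
have [psi psi_flow psiE] := integral_flow_decomposition H.
apply/is_flowP => v /=.
under eq_bigr => i _ do rewrite (psiE _ _ phi_flow) mulrz_suml.
rewrite exchange_big /= big1 // => j _; rewrite -[RHS](fM _ (psi_flow j) v (phi j)).
by rewrite mulrz_sumr; apply: eq_bigr => i _; rewrite mulrzz mulrzA.
Qed.

(** * Finitely generated abelian groups *)

(** The least positive element generates, by Euclidean division; without a positive element the
    subgroup is zero. *)
Lemma int_subgroup_generator (I : int -> Prop) :
  I 0 -> (forall x y, I x -> I y -> I (x - y)) ->
  exists2 d, I d & forall x, I x -> exists q, x = q * d.
Proof.
move=> I0 IB.
have IN x : I x -> I (- x) by move=> Ix; rewrite -sub0r; apply: IB.
have ID x y : I x -> I y -> I (x + y).
  by move=> Ix Iy; rewrite -[y]opprK; apply/IB/IN.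
have IM (q : int) x : I x -> I (q * x).
  move=> Ix; have IMn (n : nat) : I (n%:Z * x).
    elim: n => [|n IHn]; first by rewrite mul0r.
    by rewrite intS mulrDl mul1r; apply: ID.
  by case: q => n //; rewrite NegzE mulNr; apply: IN.
have [[n [n_gt0 In]]|noI] := pselect (exists n : nat, (0 < n)%N /\ I n%:Z).
  have exI : exists n, (0 < n)%N && `[< I n%:Z >].
    by exists n; rewrite n_gt0; apply/asboolP.
  case: (ex_minnP exI) => d /andP[d_gt0 /asboolP Id] min_d.
  exists d%:Z => // x Ix; exists (x %/ d%:Z)%Z.
  rewrite [LHS](divz_eq x d%:Z); apply/eqP; rewrite -subr_eq0 addrAC subrr add0r.
  have Ir : I (x %% d%:Z)%Z.
    by rewrite /modz; apply: IB => //; apply: IM.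
  have d_neq0 : d%:Z != 0 by rewrite -absz_gt0.
  have := modz_ge0 x d_neq0; case Er: (x %% d%:Z)%Z Ir => [[|r]|//] // Ir _.
  have := min_d r.+1; rewrite /= => /(_ (asboolT Ir)).
  have : (x %% d%:Z < d%:Z)%Z%R by rewrite ltz_pmod // ltz_nat.
  by rewrite Er ltz_nat ltnNge => /negPf->.
exists 0 => // x Ix; exists 0; rewrite mulr0.
have Iabs : I `|x|%N%:Z by case: x Ix => [n|n] // /IN; rewrite NegzE opprK.
apply/eqP; rewrite -absz_eq0 eqn0Ngt; apply/negP => x_gt0.
by apply: noI; exists `|x|%N.
Qed.

(** Induction on [m]: the first coordinates of elements of [K] form a subgroup generated by some
    [d]. One element of [K] starting with [d], together with generators of the elements starting
    with 0, spans [K]; this gives a block triangular square matrix. *)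
Lemma row_subgroup_span m (K : 'rV[int]_m -> Prop) :
  K 0 -> (forall u v, K u -> K v -> K (u - v)) ->
  exists B : 'M[int]_m, forall v, K v <-> exists u, v = u *m B.
Proof.
elim: m K => [|m IHm]; last rewrite -[m.+1]/(1 + m)%N; move=> K K0 KB.
  exists 0 => v; rewrite (thinmx0 v); split=> // _; exists 0.
  by rewrite mul0mx.
have [||B BE] := IHm (fun w => K (row_mx (0 : 'M_(1, 1)) w)).
- by rewrite row_mx0.
- by move=> u v Ku Kv; have := KB _ _ Ku Kv; rewrite opp_row_mx add_row_mx subrr.
have [||d [w0 Kd] d_gen] := @int_subgroup_generator
    (fun x => exists w, K (row_mx (x%:M : 'M_1) w)).
- by exists 0; rewrite raddf0 row_mx0.
- move=> x y [u Ku] [v Kv]; exists (u - v).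
  by have := KB _ _ Ku Kv; rewrite opp_row_mx add_row_mx raddfB.
have KN v : K v -> K (- v) by move=> Kv; rewrite -sub0r; apply: KB.
have KD u v : K u -> K v -> K (u + v).
  by move=> Ku Kv; rewrite -[v]opprK; apply/KB/KN.
have KM (q : int) v : K v -> K (q *: v).
  move=> Kv; have KMn (n : nat) : K (n%:Z *: v).
    elim: n => [|n IHn]; first by rewrite scale0r.
    by rewrite intS scalerDl scale1r; apply: KD.
  by case: q => n //; rewrite NegzE scaleNr; apply: KN.
exists (block_mx d%:M w0 0 B) => v; split=> [Kv|[u ->]].
  rewrite -[v](@hsubmxK _ 1 1 m) in Kv *.
  move: (lsubmx _) (rsubmx _) Kv => x w; rewrite (mx11_scalar x) => Kv.
  have [q xE] := d_gen _ (ex_intro _ w Kv).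
  have /BE[u wE] : K (row_mx (0 : 'M_1) (w - q *: w0)).
    have := KB _ _ Kv (KM q _ Kd).
    by rewrite scale_row_mx opp_row_mx add_row_mx scale_scalar_mx -xE subrr.
  exists (row_mx q%:M u); rewrite mul_row_block mulmx0 addr0 -wE.
  by rewrite mul_scalar_mx scale_scalar_mx -xE mul_scalar_mx subrKC.
rewrite -[u](@hsubmxK _ 1 1 m) mul_row_block mulmx0 addr0.
rewrite (mx11_scalar (lsubmx u)) !mul_scalar_mx.
have Kr : K (row_mx (0 : 'M_1) (rsubmx u *m B)) by apply/BE; exists (rsubmx u).
have := KD _ _ (KM (lsubmx u 0 0) _ Kd) Kr.
by rewrite scale_row_mx add_row_mx addr0.
Qed.

Lemma intr_Zp_eq0 n (k : int) :
  (1 < n)%N -> (k%:~R == 0 :> 'Z_n) = (n %| `|k|)%N.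
Proof.
move=> n_gt1.
have E m : (m%:R == 0 :> 'Z_n) = (n %| m)%N by rewrite -val_eqE /= val_Zp_nat.
by case: k => m; rewrite ?NegzE ?mulrNz ?oppr_eq0 ?abszN -pmulrn E.
Qed.

(** The map [q] presents the quotient of the free group by the diagonal lattice of [d]. Each entry 0
    contributes a free coordinate, each unit nothing, and any other entry a cyclic factor with
    multiplicity 1. *)
Lemma diagonal_presentation (d : seq int) :
  exists (a : nat) (s : seq (nat * nat)),
    all (fun p => (1 < p.1)%N && (0 < p.2)%N) s /\
    exists q : 'rV[int]_(size d) -> ('rV[int]_a * torsion_part s)%type,
      [/\ zmod_morphism q, forall y, exists v, q v = y
        & forall v, q v = 0 <-> forall i, exists c, v 0 i = c * d`_i].
Proof.
elim: d => [|d0 d [a [s [s_ok [q [qB q_surj q_ker]]]]]].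
  exists 0, [::]; split=> //; exists (fun=> 0); split=> [u v|[y1 y2]|v].
  - by rewrite subrr.
  - by exists 0; rewrite [y1]thinmx0 [y2]thinmx0.
  - by split=> // _ [].
rewrite -[size (d0 :: d)]/(1 + size d)%N.
pose l (v : 'rV[int]_(1 + size d)) : int := v 0 0.
pose r (v : 'rV[int]_(1 + size d)) := rsubmx v.
have lB : zmod_morphism l by move=> u v; rewrite /l !mxE.
have rB : zmod_morphism r by move=> u v; rewrite /r raddfB.
have lr x w : exists2 v, l v = x & r v = w.
  exists (row_mx x%:M w); rewrite /l /r ?row_mxKr //.
  have -> : 0 = lshift (size d) (0 : 'I_1) by apply: val_inj.
  by rewrite row_mxEl mxE eqxx.
have ker_lr (v : 'rV[int]_(1 + size d)) : (forall i, exists c, v 0 i = c * (d0 :: d)`_i) <->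
    (exists c, l v = c * d0) /\ q (r v) = 0.
  rewrite q_ker; split=> [H|[H0 H] i].
    split=> [|i]; first exact: (H 0).
    by have [c cE] := H (rshift 1 i); exists c; rewrite mxE cE.
  case: (unliftP 0 i) => [j ->|-> //].
  have [c cE] := H j; exists c; rewrite -[RHS]cE mxE; congr (v _ _).
  exact: val_inj.
case: (eqVneq d0 0) => [d00|d0_neq0].
  exists (1 + a)%N, s; split=> //.
  exists (fun v => (row_mx (l v)%:M (q (r v)).1 : 'rV_(1 + a), (q (r v)).2)).
  split=> [u v|[y1 y2]|v].
  - rewrite lB rB qB; apply: injective_projections => //=.
    by rewrite opp_row_mx add_row_mx raddfB.
  - have [w wE] := q_surj (rsubmx (y1 : 'rV_(1 + a)), y2).
    have [v lv rv] := lr (lsubmx (y1 : 'rV_(1 + a)) 0 0) w; exists v.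
    by rewrite lv rv wE -mx11_scalar hsubmxK.
  - rewrite ker_lr; split=> [|[[c ->] ->]]; last first.
      by rewrite d00 mulr0 raddf0 row_mx0.
    case; rewrite -[0 in X in X -> _](@row_mx0 _ 1 1 a) => /eq_row_mx[l0 q1] q2.
    split; last by rewrite [LHS]surjective_pairing q1 q2.
    by exists 0; rewrite mul0r; move/matrixP/(_ 0 0): l0; rewrite !mxE eqxx.
have [d0_unit|d0_big] := eqVneq `|d0|%N 1%N.
  exists a, s; split=> //; exists (q \o r).
  split=> [u v|y|v] /=.
  - by rewrite rB qB.
  - by have [w <-] := q_surj y; have [v _ <-] := lr 0 w; exists v.
  - rewrite ker_lr; split=> [->|[]//]; split=> //.
    have d0_sqr : d0 * d0 = 1 by case: (d0) d0_unit => [[|[|n]]|[|n]].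
    by exists (l v * d0); rewrite -mulrA d0_sqr mulr1.
have d0_gt1 : (1 < `|d0|)%N.
  by rewrite ltn_neqAle eq_sym d0_big absz_gt0.
exists a, ((`|d0|%N, 1%N) :: s); split; first by rewrite /= d0_gt1.
exists (fun v => ((q (r v)).1, (((l v)%:~R)%:M : 'rV['Z_`|d0|]_1, (q (r v)).2))).
split=> [u v|[y1 [y2 y3]]|v].
- rewrite lB rB qB mulrzBr.
  do 2![apply: injective_projections => //=].
  by rewrite raddfB.
- have [w wE] := q_surj (y1, y3).
  have [v lv rv] := lr (y2 0 0 : nat)%:Z w; exists v.
  by rewrite lv rv wE /= [y2 in RHS]mx11_scalar -[in RHS](natr_Zp (y2 0 0)).
- rewrite ker_lr; split=> [[q1 l0 q2]|[[c ->] ->]].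
    split; last by rewrite [LHS]surjective_pairing q1 q2.
    move/matrixP/(_ 0 0): l0; rewrite !mxE eqxx => /eqP.
    rewrite intr_Zp_eq0 // => dvd.
    by apply/dvdzP.
  congr (_, (_, _)). have /eqP -> : (c * d0)%:~R == 0 :> 'Z_`|d0|.
    by rewrite intr_Zp_eq0 // abszM dvdn_mull.
  by rewrite raddf0.
Qed.

(** [M] is a quotient of a free group of rank [m] by a row span. Smith normal form turns this span
    into a diagonal lattice, up to the change of basis [R]. *)
Lemma decomposition_exists (M : zmodType) :
  finitely_generated M -> exists a s, decomposition M a s.
Proof.
move=> [m [gen genM]].
pose g (v : 'rV[int]_m) := \sum_(i < m) gen`_i *~ v 0 i.
have gB : zmod_morphism g.
  move=> u v; rewrite /g -sumrB; apply: eq_bigr => i _.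
  by rewrite !mxE mulrzBr.
have g0 : g 0 = 0 by rewrite -[0 in LHS](subrr 0) gB subrr.
have [||B BE] := @row_subgroup_span m (fun v => g v = 0) => //.
  by move=> u v gu gv; rewrite gB gu gv subrr.
have [L Lu [R Ru [d0 _ BLDR]]] := int_Smith_normal_form B.
(* The diagonal is brought to length exactly [m]; missing entries are read as 0. *)
pose d := mkseq (nth 0 d0) m.
have [a [s [s_ok]]] := diagonal_presentation d.
rewrite size_mkseq => -[q [qB q_surj q_ker]].
have kerE v : q v = 0 <-> g (v *m R) = 0.
  rewrite q_ker BE BLDR; split=> [H|[u uE] i].
    have [c cE] := choice H.
    exists ((\row_i c i) *m invmx L).
    rewrite !mulmxA mulmxKV //; congr (_ *m _); apply/rowP => j.
    rewrite !mxE (bigD1 j) //= big1 ?addr0 => [|k kj].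
      by rewrite !mxE eqxx mulr1n cE nth_mkseq.
    by rewrite !mxE val_eqE (negPf kj) mulr0.
  exists ((u *m L) 0 i); rewrite nth_mkseq //.
  have -> : v = (u *m L) *m (\matrix_(i, j) (d0`_i *+ (i == j :> nat))).
    by rewrite -[v](mulmxK Ru) uE !mulmxA mulmxK.
  rewrite mxE (bigD1 i) //= big1 ?addr0 => [|k ki].
    by rewrite [X in _ * X]mxE eqxx mulr1n.
  by rewrite [X in _ * X]mxE val_eqE (negPf ki) mulr0.
have g_surj x : exists v, g (v *m R) = x.
  have [c ->] := genM x; exists ((\row_i c i) *m invmx R).
  by rewrite mulmxKV //; apply: eq_bigr => i _; rewrite mxE.
(* The section [p] need not be additive, but [q \o p] is: by [kerE], [q] takes the same value on all
   preimages of a point. *)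
have [p pK] := choice g_surj.
have qp v x : g (v *m R) = x -> q v = q (p x).
  move=> gv; apply: subr0_eq; rewrite -qB; apply/kerE.
  by rewrite mulmxBl gB gv pK subrr.
have hB : zmod_morphism (q \o p).
  by move=> x y /=; rewrite -qB; apply/esym/qp; rewrite mulmxBl gB !pK.
pose h : {additive M -> _} := HB.pack (q \o p) (GRing.isZmodMorphism.Build _ _ _ hB).
exists a, s; split=> //; exists h.
have [t tK] := choice q_surj.
exists (fun y => g (t y *m R)) => [x|y] /=.
  rewrite -[RHS]pK; apply: subr0_eq; rewrite -gB -mulmxBl; apply/kerE.
  by rewrite qB tK subrr.
by rewrite -(qp (t y)).
Qed.

(** * Integers annihilating a finitely generated group *)

Lemma annihilates_iso (M N : zmodType) (h : {additive M -> N}) (k : int) :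
  bijective h -> annihilates M k <-> annihilates N k.
Proof.
move=> [h' hK h'K]; split=> H x.
  by rewrite -[x]h'K -raddfMz H raddf0.
by apply: (can_inj hK); rewrite raddfMz H raddf0.
Qed.

Lemma annihilates_prod (M N : zmodType) (k : int) :
  annihilates (M * N)%type k <-> annihilates M k /\ annihilates N k.
Proof.
have pairMz (p : M * N) : p *~ k = (p.1 *~ k, p.2 *~ k).
  by rewrite [LHS]surjective_pairing !raddfMz.
split=> [H|[HM HN] p]; last by rewrite pairMz HM HN.
by split=> x; [have := H (x, 0)|have := H (0, x)]; rewrite pairMz => -[].
Qed.

Lemma annihilates_row (R : pzRingType) b (k : int) :
  (0 < b)%N -> annihilates 'rV[R]_b k <-> k%:~R = 0 :> R.
Proof.
move=> b_gt0; split=> [H|k0 x].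
  (* The all-ones row detects the multiples of 1 in [R], once there is a coordinate to read. *)
  have /rowP/(_ (Ordinal b_gt0)) := H (const_mx 1).
  by rewrite -scaler_int !mxE mulr1.
by rewrite -scaler_int k0 scale0r.
Qed.

Lemma annihilates_row0 (M : zmodType) (k : int) : annihilates 'rV[M]_0 k.
Proof. by move=> x; apply/rowP => -[]. Qed.

Lemma annihilates_torsion_part (s : seq (nat * nat)) (k : int) :
  all (fun p => (1 < p.1)%N && (0 < p.2)%N) s ->
  annihilates (torsion_part s) k <-> (\big[lcmn/1%N]_(p <- s) p.1 %| `|k|)%N.
Proof.
elim: s => [|[n b] s IHs] /= => [_|/andP[/andP[n_gt1 b_gt0] /IHs {}IHs]].
  by rewrite big_nil dvd1n; split=> // _; apply: annihilates_row0.
rewrite big_cons dvdn_lcm /= annihilates_prod annihilates_row // IHs.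
rewrite -(intr_Zp_eq0 k n_gt1); split=> [[k0 ->]|/andP[/eqP k0 ->] //].
by rewrite k0 eqxx.
Qed.

Definition annihilator (n : option nat) (k : int) : Prop :=
  if n is Some n then is_true (n %| `|k|)%N else k = 0.

Lemma annihilates_decomposition (M : zmodType) a s (k : int) :
  decomposition M a s ->
  annihilates M k <-> annihilator (decomposition_value a s) k.
Proof.
move=> [s_ok [h h_bij]]; rewrite (annihilates_iso k h_bij) annihilates_prod.
rewrite annihilates_torsion_part // /decomposition_value.
case: a h h_bij => [|a] _ _ /=.
  by split=> [[]|] //; split=> //; apply: annihilates_row0.
rewrite annihilates_row // intz; by split=> [[]//|->]; rewrite dvdn0.
Qed.

(** The set from which [xget] chooses is inhabited, so [n_of M] is the value of some decomposition,
    and [annihilates_decomposition] applies to whichever was chosen. *)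
Lemma annihilates_n_of (M : zmodType) (k : int) :
  finitely_generated M -> annihilates M k <-> annihilator (n_of M) k.
Proof.
move=> /decomposition_exists[a [s decM]].
have /(classical_sets.xgetPex None) [a' [s' [decM' nE]]] : exists n, exists a s,
    decomposition M a s /\ n = decomposition_value a s by exists (decomposition_value a s), a, s.
by rewrite /n_of nE; apply: annihilates_decomposition.
Qed.

Theorem theorem2p4 (G H : digraph) (M N : zmodType)
    (fgM : finitely_generated M) (fgN : finitely_generated N)
    (nMN : n_of M = n_of N) :
  nb_flow_continuous M G H = nb_flow_continuous N G H.
Proof.
apply: eq_card => f; rewrite !inE; apply: asbool_equiv_eq.
rewrite !flow_continuousP.
have MN k : annihilates M k <-> annihilates N k.
  by rewrite !annihilates_n_of // nMN.
by split=> fc psi psi_flow v; apply/MN/fc.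
Qed.
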